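(* Let $d\geq 1$ and $L\geq 2$ be integers and let $\mathcal{L}:\mathbb{R}^d\to\mathbb{R}$ be differentiable. Let $u^1,\dots,u^L:[0,+\infty)\to\mathbb{R}^d$ be a solution of the gradient flow system $$\forall j\in[L],\ \forall t\geq 0,\qquad \frac{du^j(t)}{dt}+\Big(\bigodot_{k\neq j}u^k(t)\Big)\odot\nabla\mathcal{L}(\theta(t))=0,\qquad \theta(t)=\bigodot_{j=1}^L u^j(t).$$ Then the following statements hold. 1. For any $(j,k)\in[L]\times[L]$ and all $t\geq 0$, $$\frac{d}{dt}\big(u^j\odot u^j\big)(t)=\frac{d}{dt}\big(u^k\odot u^k\big)(t)=-2\,\theta(t)\odot\nabla\mathcal{L}(\theta(t)).$$ In particular, for all $t\geq 0$, $\ u^j(t)^{\odot 2}-u^j(0)^{\odot 2}=u^k(t)^{\odot 2}-u^k(0)^{\odot 2}$. 2. Let $i\in[d]$. If $j\in[L]$ satisfies $j\notin\arg\min_{k\in[L]}|u^k_i(0)|$, then $u^j_i(t)\neq 0$ for every $t>0$.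
   Context: Notation: $[L]=\{1,\dots,L\}$; $u^j_i$ is the $i$-th component of $u^j$; $\odot$ is the Hadamard (componentwise) product on $\mathbb{R}^d$, $x^{\odot 2}=x\odot x$, and $\bigodot_{j}u^j$ is the vector with $i$-th component $\prod_j u^j_i$. $\arg\min_{k\in[L]}|u^k_i(0)|$ denotes the set of all minimizing indices. The index $L$ (number of layers) is distinct from the loss function $\mathcal{L}$. *)

(* Defs.v *)
From HB Require Import structures.
From mathcomp Require Export all_boot all_order all_algebra.
From mathcomp Require Export all_classical all_reals all_analysis.

Set Implicit Arguments.
Unset Strict Implicit.
Unset Printing Implicit Defensive.

Export Order.TTheory GRing.Theory Num.Theory.
Export numFieldNormedType.Exports.

Local Open Scope classical_set_scope.
Local Open Scope ring_scope.

(* Vectors of R^d are row vectors 'rV[R]_d; the index set {1, ..., L} is 'I_L. *)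

Reserved Notation "x \odot y" (at level 40, left associativity).

Definition hadamard (R : realType) (d : nat) (x y : 'rV[R]_d) : 'rV[R]_d :=
  map2_mx *%R x y.

Notation "x \odot y" := (hadamard x y) : ring_scope.

Definition bigodot (R : realType) (d L : nat) (P : pred 'I_L)
    (v : 'I_L -> 'rV[R]_d) : 'rV[R]_d :=
  \row_i \prod_(k < L | P k) v k 0 i.

Definition gradient (R : realType) (d : nat) (f : 'rV[R]_d -> R)
    (x : 'rV[R]_d) : 'rV[R]_d :=
  \row_i 'D_(delta_mx 0 i) f x.

(* Derivative of a function whose domain is [0, +oo): only increments h != 0
   with 0 <= t + h are considered. The derivative is therefore the right
   derivative at t = 0 and the two-sided one at t > 0, and the values of f at
   negative times play no role. *)
Definition derivable_half_line (R : realType) (V : normedModType R)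
    (f : R -> V) (t : R) : Prop :=
  cvg ((fun h => h^-1 *: (f (t + h) - f t)) @
         within [set h | 0 <= t + h] 0^').

Definition derive_half_line (R : realType) (V : normedModType R)
    (f : R -> V) (t : R) : V :=
  lim ((fun h => h^-1 *: (f (t + h) - f t)) @
         within [set h | 0 <= t + h] 0^').

Definition layer_product (R : realType) (d L : nat)
    (u : 'I_L -> R -> 'rV[R]_d) (t : R) : 'rV[R]_d :=
  bigodot predT (fun k => u k t).

Definition gradient_flow (R : realType) (d L : nat) (loss : 'rV[R]_d -> R)
    (u : 'I_L -> R -> 'rV[R]_d) : Prop :=
  forall (j : 'I_L) (t : R), 0 <= t ->
    derivable_half_line (u j) t /\
    derive_half_line (u j) t
      + bigodot (fun k => k != j) (fun k => u k t)
        \odot gradient loss (layer_product u t) = 0.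

Definition argmin (R : realType) (L : nat) (f : 'I_L -> R) : set 'I_L :=
  [set k | forall l : 'I_L, f k <= f l].

(* Main.v *)
(* Along the flow, (u_i^j)^2 has derivative 2 u_i^j (u_i^j)' =
   -2 theta_i (grad loss)_i, which does not depend on j, so the differences
   (u_i^j)^2 - (u_i^k)^2 are constant in time. If |u_i^k(0)| < |u_i^j(0)| for
   some k, then (u_i^j)^2 = (u_i^k)^2 + positive constant never vanishes; no
   uniqueness theorem for the ODE is needed. *)
Require Import Defs.
From mathcomp Require Import ring lra.

Local Open Scope classical_set_scope.
Local Open Scope ring_scope.

(** A ball of matrices is a ball in each entry, and the finitely many entrywise conditions hold
    together on one set of the filter. *)
Lemma cvg_mx_coord (R : realType) (m n : nat) (T : Type) (F : set_system T)
    (FF : Filter F) (f : T -> 'M[R]_(m, n)) (M : 'M[R]_(m, n)) :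
  (forall i j, (fun x => f x i j) @ F --> M i j) -> f @ F --> M.
Proof.
move=> fM; apply/cvg_ballP => e e0; rewrite near_map.
have : \forall x \near F, forall i : 'I_m, forall j : 'I_n,
    ball (M i j) e (f x i j).
  apply: filter_forall => i; apply: filter_forall => j.
  by have /cvg_ballP/(_ _ e0) := fM i j; rewrite near_map.
by apply: filterS => x xM; split.
Qed.

#[local] Instance half_line_dnbhs_filter (R : realType) (t : R) :
  Filter (within [set h | 0 <= t + h] 0^').
Proof. by apply: within_filter; exact: dnbhs_filter. Qed.

(** Every punctured neighbourhood of 0 contains small positive increments, and these are admissible
    from any [t >= 0]. Properness gives uniqueness of limits, hence the value of
    [derive_half_line]. *)
Lemma half_line_dnbhs_proper (R : realType) (t : R) : 0 <= t ->
  ProperFilter (within [set h | 0 <= t + h] 0^').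
Proof.
move=> t0; apply: Build_ProperFilter_ex => A.
rewrite /within /= /dnbhs /within /= => /nbhs_ballP[e /= e0] eA.
exists (e / 2); apply: eA => /=.
- by rewrite /ball /= sub0r normrN gtr0_norm; lra.
- lra.
- lra.
Qed.

(** For [h != 0], [f (t + h)] is [h] times the slope plus [f t], which tends to [0 * l + f t]. *)
Lemma half_line_slope_continuous (R : realType) (f : R -> R) (t l : R) :
  (fun h => h^-1 *: (f (t + h) - f t)) @ within [set h | 0 <= t + h] 0^' --> l ->
  (fun h => f (t + h)) @ within [set h | 0 <= t + h] 0^' --> f t.
Proof.
move=> fl.
have h0 : (fun h : R => h) @ within [set h | 0 <= t + h] 0^' --> (0 : R).
  by apply: cvg_trans (@cvg_id _ (nbhs (0 : R))) => A; rewrite /within /= /dnbhs /within /=;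
    apply: filterS => x ? ? ?.
have : (fun h => h * (h^-1 *: (f (t + h) - f t)) + f t)
    @ within [set h | 0 <= t + h] 0^' --> 0 * l + f t.
  exact: (cvgD (cvgM h0 fl) (cvg_cst _)).
rewrite mul0r add0r; apply: cvg_trans; apply: near_eq_cvg.
have : \forall h \near within [set h | 0 <= t + h] 0^', h != 0.
  apply: cvg_within; exact: (@nbhs_dnbhs_neq R^o 0).
apply: filterS => h hn0.
by rewrite /GRing.scale/= mulrA divff// mul1r subrK.
Qed.

(** By the factorization of a difference of squares, the slope of the square is the slope of [f]
    times [f (t + h) + f t]. *)
Lemma half_line_slope_sqr (R : realType) (f : R -> R) (t l : R) :
  (fun h => h^-1 *: (f (t + h) - f t)) @ within [set h | 0 <= t + h] 0^' --> l ->
  (fun h => h^-1 *: (f (t + h) * f (t + h) - f t * f t))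
    @ within [set h | 0 <= t + h] 0^' --> 2 * (f t * l).
Proof.
move=> fl.
have fc := half_line_slope_continuous _ _ _ _ fl.
rewrite (_ : 2 * _ = l * (f t + f t)); last by ring.
rewrite (_ : (fun h => _) =
    (fun h => h^-1 *: (f (t + h) - f t) * (f (t + h) + f t))).
  exact: (cvgM fl (cvgD fc (cvg_cst _))).
by apply/funext => h; rewrite /GRing.scale/=; ring.
Qed.

(** Mean value theorem on [[0, t]]: it asks for a two-sided derivative only in the interior, and the
    one-sided slope at 0 supplies continuity at that endpoint. *)
Lemma half_line_slope0_cst (R : realType) (f : R -> R) :
  (forall t : R, 0 <= t -> (fun h => h^-1 *: (f (t + h) - f t))
     @ within [set h | 0 <= t + h] 0^' --> (0 : R)) ->
  forall t : R, 0 <= t -> f t = f 0.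
Proof.
move=> df t; rewrite le_eqVlt => /predU1P[<-//|t0].
have fd (x : R) : 0 < x -> is_derive x 1 f 0.
  move=> x0; have fx : h^-1 *: ((f \o shift x) (h *: 1) - f x) @[h --> 0^'] --> (0 : R).
    rewrite (_ : (fun h => _) = (fun h => h^-1 *: (f (x + h) - f x))); last first.
      by apply/funext => h; rewrite /= [h *: 1]mulr1 [h + x]addrC.
    (* For [x > 0] every increment with [|h| < x] is admissible, so near 0 the restriction to the
       half line is void and the derivative is two-sided. *)
    have hx : \forall h \near (0 : R)^', 0 <= x + h.
      apply: nbhs_dnbhs; near=> h.
      have : `|h| < x by near: h; exact: (@nbhs0_lt R R^o).
      by rewrite ltr_norml => /andP[? _]; lra.
    apply: cvg_trans (df x (ltW x0)); apply: cvg_app => A.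
    by apply: filterS2 hx => h ? hA; exact: hA.
  by apply: DeriveDef; [apply/cvg_ex; exists 0|exact/cvg_lim].
have [x x0t||c _ /eqP] := @MVT_segment R f (fun=> 0) 0 t (ltW t0).
- by apply: fd; move: x0t; rewrite in_itv/= => /andP[].
- apply/(continuous_within_itvP _ t0); split.
  + move=> x; rewrite in_itv/= => /andP[x0 _].
    by apply/differentiable_continuous/derivable1_diffP; have [] := fd _ x0.
  (* At [t = 0] the admissible nonzero increments are the positive ones, so the restricted filter
     yields continuity from the right. *)
  + have := half_line_slope_continuous _ _ _ _ (df 0 (lexx 0)).
    rewrite (_ : (fun h => f (0 + h)) = f); last by apply/funext => h; rewrite add0r.
    apply: cvg_trans; apply: cvg_app => A wA.
    have {}wA : nbhs (0 : R) (fun x : R => x != 0 -> 0 <= 0 + x -> A x) := wA.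
    change (nbhs (0 : R) (fun x : R => 0 < x -> A x)).
    apply: filterS wA => x xA x0; apply: xA.
      by rewrite gt_eqF.
    by rewrite /= add0r ltW.
  + apply: cvg_at_left_filter.
    by apply/differentiable_continuous/derivable1_diffP; have [] := fd _ t0.
- by rewrite mul0r subr_eq0 => /eqP.
Unshelve. all: by end_near. Qed.

Lemma half_line_slope_coord (R : realType) (d : nat) (f : R -> 'rV[R]_d)
    (t : R) (l : 'rV[R]_d) (i : 'I_d) :
  (fun h => h^-1 *: (f (t + h) - f t)) @ within [set h | 0 <= t + h] 0^' --> l ->
  (fun h => h^-1 *: (f (t + h) 0 i - f t 0 i))
    @ within [set h | 0 <= t + h] 0^' --> l 0 i.
Proof.
move=> fl; rewrite (_ : (fun h => _) =
    (fun M : 'rV_d => M 0 i) \o (fun h => h^-1 *: (f (t + h) - f t))).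
  exact: (continuous_cvg _ (@coord_continuous _ _ _ 0 i _) fl).
by apply/funext => h; rewrite /= !mxE.
Qed.

Lemma gradient_flow_slope_coord (R : realType) (d L : nat)
    (loss : 'rV[R]_d -> R) (u : 'I_L -> R -> 'rV[R]_d)
    (hu : gradient_flow loss u) (j : 'I_L) (i : 'I_d) (t : R) : 0 <= t ->
  (fun h => h^-1 *: (u j (t + h) 0 i - u j t 0 i))
    @ within [set h | 0 <= t + h] 0^'
    --> - (\prod_(k < L | k != j) u k t 0 i
           * gradient loss (layer_product u t) 0 i).
Proof.
move=> t0; have [du /addr0_eq/(congr1 (fun M : 'rV_d => - M 0 i))] := hu j t t0.
(* The flow equation turns the claimed limit back into a coordinate of [derive_half_line (u j) t],
   to which the slopes converge by [du]. *)
rewrite !mxE opprK => <-.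
exact: half_line_slope_coord.
Qed.

Lemma gradient_flow_slope_sqr (R : realType) (d L : nat)
    (loss : 'rV[R]_d -> R) (u : 'I_L -> R -> 'rV[R]_d)
    (hu : gradient_flow loss u) (j : 'I_L) (t : R) : 0 <= t ->
  (fun h => h^-1 *: (u j (t + h) \odot u j (t + h) - u j t \odot u j t))
    @ within [set h | 0 <= t + h] 0^'
    --> (- 2) *: (layer_product u t \odot gradient loss (layer_product u t)).
Proof.
move=> t0.
apply: cvg_mx_coord => a i; rewrite (ord1 a).
have usqr := half_line_slope_sqr R (fun s => u j s 0 i) _ _
  (gradient_flow_slope_coord _ _ _ _ _ hu j i _ t0).
rewrite (_ : (fun h => _) = (fun h => h^-1 *:
    (u j (t + h) 0 i * u j (t + h) 0 i - u j t 0 i * u j t 0 i))).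
  suff -> : ((- 2) *: (layer_product u t
      \odot gradient loss (layer_product u t))) 0 i =
    2 * (u j t 0 i * - (\prod_(k < L | k != j) u k t 0 i
           * gradient loss (layer_product u t) 0 i)) by [].
  (* The factor [u j t 0 i] produced by squaring completes the product over [k != j] to the full
     product, so the limit no longer depends on [j]. *)
  by rewrite !mxE [in LHS](bigD1 j)//=; ring.
by apply/funext => h; rewrite !mxE.
Qed.

Theorem proposition1 (R : realType) (d L : nat) (hd : (1 <= d)%N)
    (hL : (2 <= L)%N) (loss : 'rV[R]_d -> R)
    (hloss : forall x : 'rV[R]_d, differentiable loss x)
    (u : 'I_L -> R -> 'rV[R]_d) (hu : gradient_flow loss u) :
  (forall j k : 'I_L,
     (forall t : R, 0 <= t ->
        [/\ derivable_half_line (fun s => u j s \odot u j s) t,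
            derivable_half_line (fun s => u k s \odot u k s) t,
            derive_half_line (fun s => u j s \odot u j s) t
              = derive_half_line (fun s => u k s \odot u k s) t
          & derive_half_line (fun s => u k s \odot u k s) t
              = (- 2) *: (layer_product u t
                            \odot gradient loss (layer_product u t))]) /\
     (forall t : R, 0 <= t ->
        u j t \odot u j t - u j 0 \odot u j 0
          = u k t \odot u k t - u k 0 \odot u k 0)) /\
  (forall (i : 'I_d) (j : 'I_L),
     j \notin argmin (fun k : 'I_L => `|u k 0 0 i|) ->
     forall t : R, 0 < t -> u j t 0 i != 0).
Proof.
have conserved (j k : 'I_L) (t : R) : 0 <= t ->
    u j t \odot u j t - u j 0 \odot u j 0
      = u k t \odot u k t - u k 0 \odot u k 0.
  move=> t0; apply/rowP => i.
  pose f s := (u j s 0 i) ^+ 2 - (u k s 0 i) ^+ 2.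
  suff : f t = f 0 by rewrite /f !mxE; lra.
  apply: (half_line_slope0_cst R f _ t t0) => {t t0} t t0.
  have sj := half_line_slope_coord _ _ (fun s => u j s \odot u j s) _ _ i
    (gradient_flow_slope_sqr _ _ _ _ _ hu j _ t0).
  have sk := half_line_slope_coord _ _ (fun s => u k s \odot u k s) _ _ i
    (gradient_flow_slope_sqr _ _ _ _ _ hu k _ t0).
  (* Both squares have the same limit slope, so [f] has slope 0 at every time. *)
  have := cvgB (FF := half_line_dnbhs_filter R t) sj sk; rewrite subrr.
  rewrite [X in fmap X _](_ : _ = (fun h => h^-1 *: (f (t + h) - f t))) //.
  by apply/funext => h; rewrite !fctE /f /GRing.scale/= !mxE; ring.
split=> [j k|i j jmin t t0].
  split=> [t t0|]; last exact: conserved.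
  have FF := half_line_dnbhs_proper _ _ t0.
  have sj := gradient_flow_slope_sqr _ _ _ _ _ hu j _ t0.
  have sk := gradient_flow_slope_sqr _ _ _ _ _ hu k _ t0.
  rewrite /derivable_half_line /derive_half_line.
  (* [cvg] means convergence to the [lim], so replacing the [lim] also reduces the derivability
     goals to [sj] and [sk]. *)
  have -> := cvg_lim (@norm_hausdorff _ _) sj.
  have -> := cvg_lim (@norm_hausdorff _ _) sk.
  by split.
move: jmin; rewrite notin_setE /argmin /= => /existsNP[k /negP].
rewrite -ltNge => ukj; apply/eqP => ujt.
(* If [u j t 0 i] vanished, conservation would make the square of [u k t 0 i] equal to that of
   [u k 0 0 i] minus that of [u j 0 0 i], which is negative. *)
have := congr1 (fun M : 'rV_d => M 0 i) (conserved j k t (ltW t0)).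
rewrite !mxE ujt => E.
have : `|u k 0 0 i| ^+ 2 < `|u j 0 0 i| ^+ 2 by rewrite ltr_pXn2r ?nnegrE.
rewrite !real_normK ?num_real// => lt2.
have := sqr_ge0 (u k t 0 i); rewrite !expr2 in lt2 *; lra.
Qed.
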